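(* Consider the single stage pricing game with linear loyalty described in the context, with parameters $c_A\ge c_B\ge 0$, $l_\alpha,l_\beta>0$, $s_\alpha,s_\beta\ge 0$, $\theta\in(0,1)$, and $F$ the distribution function of the uniform distribution on $[0,1]$. Suppose (Region VI) $$s_\alpha+2l_\alpha\le c_A-c_B\le l_\beta-s_\beta .$$ Then the game has a unique pure Nash equilibrium, and its prices are $$p_A^\alpha=c_A,\quad p_A^\beta=\tfrac13(c_B+2c_A-s_\beta+l_\beta),\quad p_B^\beta=\tfrac13(2c_B+c_A+s_\beta+2l_\beta),\quad p_B^\alpha=c_A-s_\alpha-l_\alpha .$$
   Context: Two firms $A$ and $B$ sell the same product, with unit product costs $c_A$ and $c_B$, where $c_A\ge c_B\ge 0$. Customers are partitioned into a set $\alpha$ (ex ante loyal to $A$; a fraction $\theta$ of the market; $A$'s strong and $B$'s weak sub-market) and a set $\beta$ (ex ante loyal to $B$; a fraction $1-\theta$; $B$'s strong and $A$'s weak sub-market). Both firms can tell the two sets apart. Each customer buys exactly one unit, from $A$ or from $B$. Firms move simultaneously: $A$ chooses $(p_A^\alpha,p_A^\beta)$ with $p_A^\alpha,p_A^\beta\ge c_A$, and $B$ chooses $(p_B^\beta,p_B^\alpha)$ with $p_B^\beta,p_B^\alpha\ge c_B$; the superscript is the set of customers to which the price is offered. Linear loyalty: a customer in $\alpha$ has loyalty level $l_\alpha\xi+s_\alpha$ and buys from $A$ iff $l_\alpha\xi+s_\alpha\ge p_A^\alpha-p_B^\alpha$; a customer in $\beta$ has loyalty level $l_\beta\xi+s_\beta$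 and buys from $B$ iff $l_\beta\xi+s_\beta\ge p_B^\beta-p_A^\beta$; here $\xi$ is random with distribution function $F$. Put $\xi^\alpha=(p_A^\alpha-p_B^\alpha-s_\alpha)/l_\alpha$ and $\xi^\beta=(p_B^\beta-p_A^\beta-s_\beta)/l_\beta$. For the uniform distribution, $F(x)=0$ for $x\le 0$, $F(x)=x$ for $0\le x\le1$, $F(x)=1$ for $x\ge1$. Profits: firm $A$ gets $(p_A^\alpha-c_A)\,\theta\,(1-F(\xi^\alpha))+(p_A^\beta-c_A)(1-\theta)F(\xi^\beta)$; firm $B$ gets $(p_B^\beta-c_B)(1-\theta)(1-F(\xi^\beta))+(p_B^\alpha-c_B)\,\theta\,F(\xi^\alpha)$. A pure Nash equilibrium is a price profile $(p_A^\alpha,p_A^\beta,p_B^\beta,p_B^\alpha)$ from which neither firm can strictly increase its profit by unilaterally changing its own (feasible) prices. *)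

(* Defs.v *)
From mathcomp Require Import all_boot all_order all_algebra.
From mathcomp Require Import reals.

Set Implicit Arguments.
Unset Strict Implicit.
Unset Printing Implicit Defensive.

Import Order.TTheory GRing.Theory Num.Theory.
Local Open Scope ring_scope.

(* Suffixes: A, B are the firms; a, b are the sub-markets alpha (ex ante loyal
   to A, fraction theta) and beta (ex ante loyal to B, fraction 1 - theta).
   F is the distribution function of the random variable driving loyalty. *)
Record game (R : realType) := Game {
  cA : R;
  cB : R;
  la : R;
  sa : R;
  lb : R;
  sb : R;
  theta : R;
  F : R -> R }.

Record profile (R : realType) := Profile {
  pAa : R;
  pAb : R;
  pBb : R;
  pBa : R }.

Definition uniform_df (R : realType) (x : R) : R :=
  if x <= 0 then 0 else if x <= 1 then x else 1.

(* An alpha customer leaves A iff l_alpha * xi + s_alpha < pAa - pBa, that is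
   iff xi < xi_a; symmetrically for beta. *)
Definition xi_a (R : realType) (G : game R) (p : profile R) : R :=
  (pAa p - pBa p - sa G) / la G.

Definition xi_b (R : realType) (G : game R) (p : profile R) : R :=
  (pBb p - pAb p - sb G) / lb G.

Definition profitA (R : realType) (G : game R) (p : profile R) : R :=
  (pAa p - cA G) * theta G * (1 - F G (xi_a G p))
  + (pAb p - cA G) * (1 - theta G) * F G (xi_b G p).

Definition profitB (R : realType) (G : game R) (p : profile R) : R :=
  (pBb p - cB G) * (1 - theta G) * (1 - F G (xi_b G p))
  + (pBa p - cB G) * theta G * F G (xi_a G p).

Definition feasibleA (R : realType) (G : game R) (p : profile R) : Prop :=
  cA G <= pAa p /\ cA G <= pAb p.

Definition feasibleB (R : realType) (G : game R) (p : profile R) : Prop :=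
  cB G <= pBb p /\ cB G <= pBa p.

Definition deviateA (R : realType) (p : profile R) (xa xb : R) : profile R :=
  {| pAa := xa; pAb := xb; pBb := pBb p; pBa := pBa p |}.

Definition deviateB (R : realType) (p : profile R) (xb xa : R) : profile R :=
  {| pAa := pAa p; pAb := pAb p; pBb := xb; pBa := xa |}.

Definition pure_nash (R : realType) (G : game R) (p : profile R) : Prop :=
  [/\ feasibleA G p,
      feasibleB G p,
      forall xa xb : R, feasibleA G (deviateA p xa xb) ->
        profitA G (deviateA p xa xb) <= profitA G p
    & forall xb xa : R, feasibleB G (deviateB p xb xa) ->
        profitB G (deviateB p xb xa) <= profitB G p].

(* Main.v *)
Require Import Defs.
From mathcomp Require Import all_boot all_order all_algebra.
From mathcomp Require Import reals.
From mathcomp Require Import ring lra.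

Set Implicit Arguments.
Unset Strict Implicit.
Unset Printing Implicit Defensive.

Import Order.TTheory GRing.Theory Num.Theory.
Local Open Scope ring_scope.

(* Customer groups are priced independently, so an equilibrium is one best
   reply in each group for each firm.  Since 1 - F t = F (1 - t) for the uniform
   distribution, all four problems are the same one: a seller with cost c facing
   the demand F ((v - p) / l), where the choke price v is p_A^alpha - s_alpha
   for the weak seller and p_B^alpha + s_alpha + l_alpha for the strong one (and
   likewise for beta).  When c < v the unique best price is the larger of v - l,
   which just captures everybody, and the monopoly price (v + c) / 2; when
   v <= c every price p >= c yields 0.  Solving these piecewise linear best-reply
   equations gives the unique equilibrium. *)

Definition seller_profit (R : realType) (l c v p : R) : R :=
  (p - c) * uniform_df ((v - p) / l).

Definition best_price (R : realType) (l c v p : R) : Prop :=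
  c <= p /\ forall q, c <= q -> seller_profit l c v q <= seller_profit l c v p.

Lemma uniform_dfC (R : realType) (t : R) :
  1 - uniform_df t = uniform_df (1 - t).
Proof. by rewrite /uniform_df; do ![case: leP => ?]; lra. Qed.

Lemma seller_profit0 (R : realType) (l c v p : R) :
  0 < l -> v <= p -> seller_profit l c v p = 0.
Proof.
move=> l0 vp; rewrite /seller_profit /uniform_df ler_pdivrMr // mul0r subr_le0.
by rewrite vp mulr0.
Qed.

Lemma seller_profit_interior (R : realType) (l c v p : R) :
  0 < l -> v - l <= p -> p <= v ->
  seller_profit l c v p = (p - c) * (v - p) / l.
Proof.
move=> l0 vlp pv; rewrite /seller_profit /uniform_df !ler_pdivrMr // mul0r mul1r.
case: ifP => [vp|_]; last by rewrite (_ : v - p <= l) ?mulrA //; lra.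
by have -> : v - p = 0 by [lra]; rewrite !mulr0 mul0r.
Qed.

Lemma seller_profit_full (R : realType) (l c v p : R) :
  0 < l -> p <= v - l -> seller_profit l c v p = p - c.
Proof.
move=> l0 pvl; rewrite /seller_profit /uniform_df !ler_pdivrMr // mul0r mul1r.
case: ifP => [vp|_]; first by lra.
case: ifP => [vp|_]; last by rewrite mulr1.
by have -> : v - p = l by [lra]; rewrite divff ?mulr1 ?gt_eqF.
Qed.

(** Between [v - l] and [v] the profit is a concave quadratic with vertex [(v + c) / 2]; below
    [v - l] it rises with slope 1. The strict inequality is what makes the best reply unique. *)
Lemma seller_profit_lt_max (R : realType) (l c v p : R) :
  0 < l -> c < v -> c <= p -> p <> Num.max (v - l) ((v + c) / 2) ->
  seller_profit l c v p < seller_profit l c v (Num.max (v - l) ((v + c) / 2)).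
Proof.
move=> l0 cv cp; case: (leP (v - l)) => [vlm|mvl] pm.
- rewrite (@seller_profit_interior _ _ _ _ ((v + c) / 2)) //; last by lra.
  rewrite ltr_pdivlMr //.
  have [vp|pv] := leP v p; first by rewrite seller_profit0 // mul0r; nra.
  have [pvl|vlp] := leP p (v - l).
    rewrite seller_profit_full //.
    (* Here [l <= v - p], so [(p - c) * l] is at most [(p - c) * (v - p)], which is below its vertex
       value. *)
    have pm' : p < (v + c) / 2 by move/eqP: pm => pm; rewrite lt_neqAle pm; lra.
    by nra.
  rewrite seller_profit_interior ?(ltW vlp) ?(ltW pv) // divfK ?gt_eqF //.
  (* This square is exactly [l] times the profit gap. *)
  have : 0 < (p - (v + c) / 2) ^+ 2.
    by rewrite exprn_even_gt0 //= subr_eq0; apply/eqP.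
  by nra.
- rewrite (@seller_profit_full _ _ _ _ (v - l)) //.
  have [vp|pv] := leP v p; first by rewrite seller_profit0 //; lra.
  have [pvl|vlp] := leP p (v - l).
    rewrite seller_profit_full // ltrD2r lt_neqAle pvl andbT.
    exact/eqP.
  rewrite seller_profit_interior ?(ltW vlp) ?(ltW pv) // ltr_pdivrMr //.
  (* The gap, times [l], is [(p - (v - l)) * (p - l - c)], with both factors positive. *)
  by nra.
Qed.

Lemma best_priceP (R : realType) (l c v p : R) : 0 < l -> c < v ->
  best_price l c v p <-> p = Num.max (v - l) ((v + c) / 2).
Proof.
move=> l0 cv.
have cm : c <= Num.max (v - l) ((v + c) / 2) by rewrite le_max; lra.
split=> [[cp pmax]|->].
  apply/eqP/negP => /negP/eqP pm.
  by have := seller_profit_lt_max l0 cv cp pm; rewrite ltNge pmax.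
split=> // q cq; have [->//|/eqP qm] := eqVneq q (Num.max (v - l) ((v + c) / 2)).
exact/ltW/seller_profit_lt_max.
Qed.

Lemma best_price_le_cost (R : realType) (l c v p : R) :
  0 < l -> v <= c -> c <= p -> best_price l c v p.
Proof.
move=> l0 vc cp; split=> // q cq.
by rewrite !seller_profit0 // (le_trans vc).
Qed.

Lemma best_prices_separate (R : realType) (a b l c v l' v' p p' : R) :
  0 < a -> 0 < b ->
  (c <= p /\ c <= p') /\
  (forall q q', c <= q /\ c <= q' ->
     a * seller_profit l c v q + b * seller_profit l' c v' q' <=
     a * seller_profit l c v p + b * seller_profit l' c v' p') <->
  best_price l c v p /\ best_price l' c v' p'.
Proof.
move=> a0 b0; split=> [[[cp cp'] opt]|[[cp opt] [cp' opt']]]; split=> //.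
(* Deviating in one group while keeping the other price fixed cancels the other summand. *)
- by split=> // q cq; rewrite -(ler_pM2l a0); have := opt q p' (conj cq cp'); lra.
- by split=> // q cq; rewrite -(ler_pM2l b0); have := opt p q (conj cp cq); lra.
- by move=> q q' [cq cq']; rewrite lerD // ler_pM2l ?opt ?opt'.
Qed.

Lemma strong_demand (R : realType) (l s x y : R) : 0 < l ->
  1 - uniform_df ((x - y - s) / l) = uniform_df ((y + s + l - x) / l).
Proof.
by move=> l0; rewrite uniform_dfC; congr uniform_df; field; rewrite gt_eqF.
Qed.

Section UniformGame.
Variables (R : realType) (G : game R).
Hypotheses (uniformF : F G = @uniform_df R).
Hypotheses (la_gt0 : 0 < la G) (lb_gt0 : 0 < lb G).
Hypotheses (theta_gt0 : 0 < theta G) (theta_lt1 : theta G < 1).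

Lemma profitA_uniform (p : profile R) :
  profitA G p =
    theta G * seller_profit (la G) (cA G) (pBa p + sa G + la G) (pAa p) +
    (1 - theta G) * seller_profit (lb G) (cA G) (pBb p - sb G) (pAb p).
Proof.
rewrite /profitA uniformF /xi_a strong_demand // /xi_b /seller_profit.
by rewrite (addrAC (pBb p)) !mulrA ![_ * (_ - cA G)]mulrC.
Qed.

Lemma profitB_uniform (p : profile R) :
  profitB G p =
    (1 - theta G) * seller_profit (lb G) (cB G) (pAb p + sb G + lb G) (pBb p) +
    theta G * seller_profit (la G) (cB G) (pAa p - sa G) (pBa p).
Proof.
rewrite /profitB uniformF /xi_b strong_demand // /xi_a /seller_profit.
by rewrite (addrAC (pAa p)) !mulrA ![_ * (_ - cB G)]mulrC.
Qed.

Lemma pure_nash_best_price (p : profile R) :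
  pure_nash G p <->
  (best_price (la G) (cA G) (pBa p + sa G + la G) (pAa p) /\
   best_price (lb G) (cA G) (pBb p - sb G) (pAb p)) /\
  (best_price (lb G) (cB G) (pAb p + sb G + lb G) (pBb p) /\
   best_price (la G) (cB G) (pAa p - sa G) (pBa p)).
Proof.
have theta'_gt0 : 0 < 1 - theta G by rewrite subr_gt0.
rewrite -(best_prices_separate _ _ _ _ _ _ _ theta_gt0 theta'_gt0).
rewrite -(best_prices_separate _ _ _ _ _ _ _ theta'_gt0 theta_gt0).
split=> [[fA fB optA optB]|[[fA optA] [fB optB]]].
  split; split=> // q q' fq.
    by have := optA q q' fq; rewrite !profitA_uniform.
  by have := optB q q' fq; rewrite !profitB_uniform.
split=> // q q' fq.
  by rewrite !profitA_uniform; exact: optA.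
by rewrite !profitB_uniform; exact: optB.
Qed.

End UniformGame.

(* In the two lemmas below x is the strong and y the weak seller's price. *)
Lemma submarket_overtaken (R : realType) (l s cS cW x y : R) :
  0 < l -> s + 2 * l <= cS - cW ->
  best_price l cS (y + s + l) x /\ best_price l cW (x - s) y <->
  x = cS /\ y = cS - s - l.
Proof.
move=> l0 h; split=> [[bx by_]|[-> ->]]; last first.
  (* The strong seller's choke price [y + s + l] equals its cost [cS]. *)
  split; first by apply: best_price_le_cost; lra.
  by apply/best_priceP => //; [lra|case: leP; lra].
have [cx _] := bx.
(* Since [cS <= x], the weak seller's margin [x - s - cW] is at least [2 * l], so capturing
   everybody is optimal. *)
have yE : y = x - s - l.
  by move/best_priceP: by_ => -> //; [case: leP; lra|lra].
suff xE : x = cS by split; lra.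
(* By [yE] the strong seller's choke price is [x] itself; if it exceeded [cS], the best price would
   lie strictly below it. *)
apply/le_anti; rewrite cx andbT leNgt; apply/negP => cSx.
have vx : cS < y + s + l by lra.
by move/(best_priceP _ l0 vx): bx; case: leP; lra.
Qed.

Lemma submarket_shared (R : realType) (l s cS cW x y : R) :
  0 < l -> 0 <= s -> cS <= cW -> cW - cS <= l - s ->
  best_price l cS (y + s + l) x /\ best_price l cW (x - s) y <->
  x = 3^-1 * (2 * cS + cW + s + 2 * l) /\ y = 3^-1 * (cS + 2 * cW - s + l).
Proof.
move=> l0 s0 cSW h; split=> [[bx by_]|[-> ->]]; last first.
  (* The prices solve the monopoly conditions [2 * x = y + s + l + cS] and [2 * y = x - s + cW]. *)
  split; first by apply/best_priceP => //; [lra|case: leP; lra].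
  (* At equality the weak seller's choke price falls to its cost, where [best_priceP] does not
     apply. *)
  have [d|d] := ltP (cW - cS) (l - s).
    by apply/best_priceP => //; [lra|case: leP; lra].
  by apply: best_price_le_cost; lra.
have [[cx _] [cy _]] := (bx, by_).
have vx : cS < y + s + l by lra.
move/(best_priceP _ l0 vx): bx => xE.
have [vy|vy] := ltP cW (x - s).
  (* If one seller captured everybody, the other would be pricing at its own choke price, which is
     not optimal; so both monopoly conditions hold. *)
  by move/(best_priceP _ l0 vy): by_; move: xE; do 2![case: leP => ?]; lra.
(* The weak seller's optimality no longer determines [y], but [xE] does: [y + s <= x <= cW + s]
   gives [y = cW], and the monopoly bound on [x] then forces [cW - cS = l - s]. *)
by move: xE; case: leP => ?; lra.
Qed.

Theorem proposition8 (R : realType) (c_A c_B l_a s_a l_b s_b th : R)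
    (hcB : 0 <= c_B) (hcA : c_B <= c_A)
    (hla : 0 < l_a) (hlb : 0 < l_b)
    (hsa : 0 <= s_a) (hsb : 0 <= s_b)
    (hth0 : 0 < th) (hth1 : th < 1)
    (hVIa : s_a + 2 * l_a <= c_A - c_B)
    (hVIb : c_A - c_B <= l_b - s_b) :
  let G := {| cA := c_A; cB := c_B; la := l_a; sa := s_a; lb := l_b;
              sb := s_b; theta := th; F := @uniform_df R |} in
  unique (pure_nash G)
    {| pAa := c_A;
       pAb := 3^-1 * (c_B + 2 * c_A - s_b + l_b);
       pBb := 3^-1 * (2 * c_B + c_A + s_b + 2 * l_b);
       pBa := c_A - s_a - l_a |}.
Proof.
move=> G; have nashP := @pure_nash_best_price R G erefl hla hlb hth0 hth1.
split=> [|p /nashP[[bAa bAb] [bBb bBa]]].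
  apply/nashP => /=.
  (* In alpha the strong seller is A, with the higher cost; in beta it is B, with the lower one. *)
  have [_ /(_ (conj erefl erefl)) [? ?]] :=
    submarket_overtaken c_A (c_A - s_a - l_a) hla hVIa.
  by have [_ /(_ (conj erefl erefl)) [? ?]] := submarket_shared
    (3^-1 * (2 * c_B + c_A + s_b + 2 * l_b))
    (3^-1 * (c_B + 2 * c_A - s_b + l_b)) hlb hsb hcA hVIb.
have [/(_ (conj bAa bBa)) [pAaE pBaE] _] :=
  submarket_overtaken (pAa p) (pBa p) hla hVIa.
have [/(_ (conj bBb bAb)) [pBbE pAbE] _] :=
  submarket_shared (pBb p) (pAb p) hlb hsb hcA hVIb.
by case: p pAaE pAbE pBbE pBaE {bAa bAb bBb bBa} => ? ? ? ? /= -> -> -> ->.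
Qed.
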